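(* Let $K$ be a field and let $\mathcal C$ be a $K$-linear Krull-Schmidt triangulated category with shift $[1]$ and with $\dim_K\mathrm{Hom}_{\mathcal C}(X,Y)<\infty$ for all $X,Y\in\mathcal C$. Assume that $\mathcal C$ has Auslander-Reiten triangles and a cluster tilting subcategory $\mathcal T$. Let $\psi:K_0(\mathcal C,0)\to K_0(\mathcal C)$ and $g:K_0(\mathcal C,0)\to K_0(\mathcal C,\mathcal T)$ be the canonical projections. Then the following statements are equivalent: (1) $\mathrm{Ker}(g)$ is generated by $\{[l_X]\mid X\in\mathrm{Ind}(\mathcal C)\setminus\mathcal T[1]\}$; (2) $\mathrm{Ker}(\psi)$ is generated by $\{[l_X]\mid X\in\mathrm{Ind}(\mathcal C)\}$; (3) $\mathcal C$ is locally finite.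
   Context: Standing assumption: not all objects of $\mathcal C$ are projective and injective in the extriangulated sense, i.e. $\mathcal C$ is nonzero. All subcategories are full additive subcategories closed under isomorphisms. $\mathrm{Ind}(\mathcal C)$ is the set of isomorphism classes of indecomposable objects of $\mathcal C$. $\mathcal C$ is locally finite if for every $A\in\mathrm{Ind}(\mathcal C)$ there are only finitely many $B\in\mathrm{Ind}(\mathcal C)$ with $\mathrm{Hom}_{\mathcal C}(A,B)\neq0$ and only finitely many $B\in\mathrm{Ind}(\mathcal C)$ with $\mathrm{Hom}_{\mathcal C}(B,A)\neq0$. A subcategory $\mathcal T\subset\mathcal C$ closed under finite direct sums and direct summands is a cluster tilting subcategory if (1) $\mathcal T$ is functorially finite in $\mathcal C$, i.e. every $B\in\mathcal C$ admits a right $\mathcal T$-approximation (a morphism $T_B\to B$ with $T_B\in\mathcal T$ through which every morphism from an object of $\mathcal T$ to $B$ factors) and, dually, a left $\mathcal T$-approximation; and (2) $\mathcal T=\{X\in\mathcal C\mid \mathrm{Hom}_{\mathcal C}(\mathcal T,X[1])=0\}=\{X\in\mathcal C\mid\mathrm{Hom}_{\mathcal C}(X,\mathcal T[1])=0\}$. An Auslander-Reiten triangle is a triangle $X\to Y\to Z\xrightarrow{h}X[1]$ with $h\neq0$ such that $a[1]\circ h=0$ for every $a:X\to X'$ that is not a section (split monomorphism) and $h\circ c=0$ for every $c:Z'\to Z$ that is not a retraction (split epimorphism). (Then $X$ and $Z$ are indecomposable; one writes $Z=\tau^{-1}X$.) $\mathcal C$ has Auslander-Reiten triangles if every indecomposable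 object is the first term of some Auslander-Reiten triangle and the third term of some Auslander-Reiten triangle. Grothendieck groups. Let $F$ be the free abelian group on the set of isomorphism classes $[X]$ of objects of $\mathcal C$. $K_0(\mathcal C,0)$ is the quotient of $F$ by the subgroup generated by all $[A]+[B]-[A\oplus B]$ (it is free abelian on $\mathrm{Ind}(\mathcal C)$). $K_0(\mathcal C)$ is the quotient of $K_0(\mathcal C,0)$ by the subgroup generated by all $[X]+[Z]-[Y]$ with $X\to Y\to Z\to X[1]$ a triangle in $\mathcal C$. The relative Grothendieck group $K_0(\mathcal C,\mathcal T)$ is the quotient of $K_0(\mathcal C,0)$ by the relations $[X]+[Z]-[Y]$ for all triangles $X\to Y\to Z\xrightarrow{h}X[1]$ such that $h$ factors through an object of $\mathcal T[1]$. For an indecomposable $X$ with Auslander-Reiten triangle $X\to Y\to\tau^{-1}X\to X[1]$, put $[l_X]:=[X]+[\tau^{-1}X]-[Y]\in K_0(\mathcal C,0)$. *)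

(* Defs.v *)
From HB Require Import structures.
From mathcomp Require Import all_boot all_order all_algebra.
From mathcomp Require Import boolp classical_sets functions cardinality.
From mathcomp Require Import freeg.

Set Implicit Arguments.
Unset Strict Implicit.
Unset Printing Implicit Defensive.

Import GRing.Theory.
Local Open Scope classical_set_scope.
Local Open Scope ring_scope.
Local Open Scope quotient_scope.

(* [vectType K] is the type of finite-dimensional K-vector spaces, so these
   are the K-linear categories with finite-dimensional Hom-spaces. *)
Record lin_category (K : fieldType) := LinCategory {
  obj :> Type;
  hom : obj -> obj -> vectType K;
  idm : forall X, hom X X;
  mcomp : forall X Y Z, hom Y Z -> hom X Y -> hom X Z;
  compA : forall X Y Z W (h : hom Z W) (g : hom Y Z) (f : hom X Y),
    mcomp h (mcomp g f) = mcomp (mcomp h g) f;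
  comp1m : forall X Y (f : hom X Y), mcomp (idm Y) f = f;
  compm1 : forall X Y (f : hom X Y), mcomp f (idm X) = f;
  comp_linearl : forall X Y Z (f : hom X Y),
    linear (fun g : hom Y Z => mcomp g f);
  comp_linearr : forall X Y Z (g : hom Y Z),
    linear (fun f : hom X Y => mcomp g f)
}.

Arguments idm {K l} X.
Arguments mcomp {K l X Y Z} g f.

Notation "g \oc f" := (mcomp g f) (at level 40, left associativity).

Section LinCategory.
Context {K : fieldType} {C : lin_category K}.
Implicit Types X Y Z A B S : C.

Definition is_iso X Y (f : hom X Y) : Prop :=
  exists g : hom Y X, g \oc f = idm X /\ f \oc g = idm Y.

Definition isomorphic X Y : Prop := exists f : hom X Y, is_iso f.

Definition section X Y (f : hom X Y) : Prop :=
  exists g : hom Y X, g \oc f = idm X.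

Definition retraction X Y (f : hom X Y) : Prop :=
  exists g : hom Y X, f \oc g = idm Y.

Definition zero_object Z : Prop :=
  forall X, (forall f : hom X Z, f = 0) /\ (forall f : hom Z X, f = 0).

(* S, with suitable injections and projections, is a direct sum of A and B. *)
Definition is_dsum A B S : Prop :=
  exists (i1 : hom A S) (i2 : hom B S) (p1 : hom S A) (p2 : hom S B),
    [/\ p1 \oc i1 = idm A, p2 \oc i2 = idm B, p2 \oc i1 = 0, p1 \oc i2 = 0
      & i1 \oc p1 + i2 \oc p2 = idm S].

Definition is_finite_dsum n (A : 'I_n -> C) S : Prop :=
  exists (i : forall k, hom (A k) S) (p : forall k, hom S (A k)),
    [/\ forall k, p k \oc i k = idm (A k),
        forall k l, k != l -> p l \oc i k = 0
      & \sum_(k < n) i k \oc p k = idm S].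

Definition indecomposable X : Prop :=
  ~ zero_object X /\
  forall A B, is_dsum A B X -> zero_object A \/ zero_object B.

(* The endomorphism ring is nonzero and its non-units are closed under
   addition. *)
Definition local_endo X : Prop :=
  idm X <> 0 /\
  forall f g : hom X X, is_iso (f + g) -> is_iso f \/ is_iso g.

Lemma isomorphic_refl X : isomorphic X X.
Proof. by exists (idm X), (idm X); rewrite comp1m. Qed.

Lemma isomorphic_sym X Y : isomorphic X Y -> isomorphic Y X.
Proof. by case=> f [g [gf fg]]; exists g, f. Qed.

Lemma isomorphic_trans Y X Z :
  isomorphic X Y -> isomorphic Y Z -> isomorphic X Z.
Proof.
move=> [f [f' [f'f ff']]] [g [g' [g'g gg']]].
exists (g \oc f), (f' \oc g'); split.
  by rewrite -compA (compA g') g'g comp1m.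
by rewrite -compA (compA f) ff' comp1m.
Qed.

End LinCategory.

Arguments zero_object {K C} Z.
Arguments is_dsum {K C} A B S.
Arguments is_finite_dsum {K C n} A S.
Arguments indecomposable {K C} X.
Arguments local_endo {K C} X.

Definition additive_category {K : fieldType} (C : lin_category K) : Prop :=
  (exists Z : C, zero_object Z) /\
  (forall A B : C, exists S : C, is_dsum A B S).

Definition krull_schmidt {K : fieldType} (C : lin_category K) : Prop :=
  forall X : C, exists (n : nat) (A : 'I_n -> C),
    is_finite_dsum A X /\ forall k, local_endo (A k).

(* The shift is a K-linear autoequivalence, given as a fully faithful and
   essentially surjective functor; [triangle f g h] means that
   X -f-> Y -g-> Z -h-> X[1] is a distinguished triangle. *)
Record tri_category (K : fieldType) := TriCategory {
  tri_base :> lin_category K;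
  tri_additive : additive_category tri_base;
  shift : tri_base -> tri_base;
  shiftm : forall X Y : tri_base, {linear hom X Y -> hom (shift X) (shift Y)};
  shiftm1 : forall X, shiftm X X (idm X) = idm (shift X);
  shiftmM : forall X Y Z (g : hom Y Z) (f : hom X Y),
    shiftm X Z (g \oc f) = shiftm Y Z g \oc shiftm X Y f;
  shift_fully_faithful : forall X Y, bijective (shiftm X Y);
  shift_ess_surj : forall Y, exists X, isomorphic (shift X) Y;
  triangle : forall X Y Z, hom X Y -> hom Y Z -> hom Z (shift X) -> Prop;
  triangle_iso : forall X Y Z X' Y' Z'
    (f : hom X Y) (g : hom Y Z) (h : hom Z (shift X))
    (f' : hom X' Y') (g' : hom Y' Z') (h' : hom Z' (shift X'))
    (a : hom X X') (b : hom Y Y') (c : hom Z Z'),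
    triangle f g h -> is_iso a -> is_iso b -> is_iso c ->
    b \oc f = f' \oc a -> c \oc g = g' \oc b -> shiftm X X' a \oc h = h' \oc c ->
    triangle f' g' h';
  triangle_id : forall X Z : tri_base, zero_object Z ->
    triangle (idm X) (0 : hom X Z) (0 : hom Z (shift X));
  triangle_ex : forall X Y (f : hom X Y),
    exists Z (g : hom Y Z) (h : hom Z (shift X)), triangle f g h;
  triangle_rot : forall X Y Z (f : hom X Y) (g : hom Y Z) (h : hom Z (shift X)),
    triangle f g h <-> triangle g h (- shiftm X Y f);
  triangle_map : forall X Y Z X' Y' Z'
    (f : hom X Y) (g : hom Y Z) (h : hom Z (shift X))
    (f' : hom X' Y') (g' : hom Y' Z') (h' : hom Z' (shift X'))
    (a : hom X X') (b : hom Y Y'),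
    triangle f g h -> triangle f' g' h' -> b \oc f = f' \oc a ->
    exists c : hom Z Z', c \oc g = g' \oc b /\ shiftm X X' a \oc h = h' \oc c;
  triangle_octahedron : forall X Y Z X' Y' Z'
    (f : hom X Y) (g : hom Y Z)
    (i : hom Y Z') (i' : hom Z' (shift X))
    (j : hom Z X') (j' : hom X' (shift Y))
    (k : hom Z Y') (k' : hom Y' (shift X)),
    triangle f i i' -> triangle g j j' -> triangle (g \oc f) k k' ->
    exists (u : hom Z' Y') (v : hom Y' X'),
      triangle u v (shiftm Y Z' i \oc j') /\
      [/\ u \oc i = k \oc g, k' \oc u = i', v \oc k = j
        & j' \oc v = shiftm X Y f \oc k']
}.

Arguments shift {K t} X.
Arguments shiftm {K t X Y}.
Arguments triangle {K t X Y Z} f g h.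

Section TriCategory.
Context {K : fieldType} (C : tri_category K).
Implicit Type T : set C.

(* T[1], closed under isomorphisms *)
Definition shift_subcat T : set C :=
  [set V | exists2 U, T U & isomorphic V (shift U)].

Definition right_approx T (B U : C) (f : hom U B) : Prop :=
  T U /\ forall V (g : hom V B), T V -> exists s : hom V U, g = f \oc s.

Definition left_approx T (B U : C) (f : hom B U) : Prop :=
  T U /\ forall V (g : hom B V), T V -> exists s : hom U V, g = s \oc f.

Definition functorially_finite T : Prop :=
  forall B : C, (exists U (f : hom U B), right_approx T f) /\
                (exists U (f : hom B U), left_approx T f).

Record cluster_tilting T : Prop := {
  ct_iso : forall X Y, isomorphic X Y -> T X -> T Y;
  ct_zero : forall Z, zero_object Z -> T Z;
  ct_dsum : forall A B S, is_dsum A B S -> T A -> T B -> T S;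
  ct_summand : forall A B S, is_dsum A B S -> T S -> T A;
  ct_functorially_finite : functorially_finite T;
  ct_right : T = [set X | forall U, T U -> forall f : hom U (shift X), f = 0];
  ct_left : T = [set X | forall U, T U -> forall f : hom X (shift U), f = 0]
}.

Definition AR_triangle (X Y Z : C)
    (f : hom X Y) (g : hom Y Z) (h : hom Z (shift X)) : Prop :=
  [/\ triangle f g h, h <> 0,
      forall X' (a : hom X X'), ~ section a -> shiftm a \oc h = 0
    & forall Z' (c : hom Z' Z), ~ retraction c -> h \oc c = 0].

Definition has_AR_triangles : Prop :=
  forall A : C, indecomposable A ->
    (exists Y Z (f : hom A Y) (g : hom Y Z) (h : hom Z (shift A)),
        AR_triangle f g h) /\
    (exists X Y (f : hom X Y) (g : hom Y A) (h : hom A (shift X)),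
        AR_triangle f g h).

Definition factors_through_subcat T (X Y : C) (h : hom X Y) : Prop :=
  exists U (a : hom X U) (b : hom U Y), T U /\ h = b \oc a.

Definition iso_rel : rel {classic C} :=
  fun X Y => `[< isomorphic (X : C) (Y : C) >].

Lemma iso_rel_equiv : equiv_class_of iso_rel.
Proof.
split=> [X|X Y|Y X Z]; first exact/asboolP/isomorphic_refl.
  by apply/asboolP/asboolP => /isomorphic_sym.
by move=> /asboolP XY /asboolP YZ; apply/asboolP/(isomorphic_trans XY YZ).
Qed.

Canonical iso_rel_equivRel := EquivRelPack iso_rel_equiv.

Definition iso_class : Type := {eq_quot iso_rel}.
HB.instance Definition _ := EqQuotient.on iso_class.
HB.instance Definition _ := Choice.on iso_class.

Definition class_of (X : C) : iso_class := \pi_iso_class (X : {classic C}).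

Definition locally_finite : Prop :=
  forall A : C, indecomposable A ->
    finite_set [set b | exists B : C,
      [/\ indecomposable B, b = class_of B & exists f : hom A B, f <> 0]] /\
    finite_set [set b | exists B : C,
      [/\ indecomposable B, b = class_of B & exists f : hom B A, f <> 0]].

End TriCategory.

Section GeneratedSubgroup.
Context {G : zmodType}.

Definition subgroup_gen (E : set G) : {pred G} :=
  fun x => `[< forall H : zmodClosed G, (forall y, E y -> y \in H) -> x \in H >].

Lemma subgroup_gen_zmod_closed (E : set G) : zmod_closed (subgroup_gen E).
Proof.
split=> [|x y /asboolP Ex /asboolP Ey]; apply/asboolP => H EH; first exact: rpred0.
by apply: rpredB; [exact: Ex|exact: Ey].
Qed.

HB.instance Definition _ (E : set G) :=
  GRing.isZmodClosed.Build G (subgroup_gen E) (subgroup_gen_zmod_closed E).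

Definition quotient_by (E : set G) : zmodType := Quotient.quot (subgroup_gen E).

Definition quotient_proj (E : set G) : G -> quotient_by E :=
  \pi_(Quotient.quot (subgroup_gen E)).

End GeneratedSubgroup.

Definition Ker {G H : zmodType} (f : G -> H) : {pred G} := fun x => f x == 0.

Section Grothendieck.
Context {K : fieldType} (C : tri_category K).
Implicit Type T : set C.

Definition free_iso : zmodType := {freeg (iso_class C) / int}.

Definition free_class (X : C) : free_iso := << class_of X >>.

Definition split_relations : set free_iso :=
  [set r | exists A B S : C,
    is_dsum A B S /\ r = free_class A + free_class B - free_class S].

(* K_0(C,0) *)
Definition K0_split : zmodType := quotient_by split_relations.

Definition K0_class (X : C) : K0_split :=
  quotient_proj split_relations (free_class X).

Definition triangle_relations : set K0_split :=
  [set r | exists (X Y Z : C) (f : hom X Y) (g : hom Y Z) (h : hom Z (shift X)),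
    triangle f g h /\ r = K0_class X + K0_class Z - K0_class Y].

Definition relative_relations T : set K0_split :=
  [set r | exists (X Y Z : C) (f : hom X Y) (g : hom Y Z) (h : hom Z (shift X)),
    [/\ triangle f g h, factors_through_subcat (shift_subcat T) h
      & r = K0_class X + K0_class Z - K0_class Y]].

Definition K0 : zmodType := quotient_by triangle_relations.

(* K_0(C,T) *)
Definition K0_rel T : zmodType := quotient_by (relative_relations T).

Definition K0_proj : K0_split -> K0 := quotient_proj triangle_relations.

Definition K0_rel_proj T : K0_split -> K0_rel T := quotient_proj (relative_relations T).

(* l is the element [l_X] attached to some Auslander-Reiten triangle starting
   at X; such a triangle is unique up to isomorphism. *)
Definition is_l (X : C) (l : K0_split) : Prop :=
  exists (Y Z : C) (f : hom X Y) (g : hom Y Z) (h : hom Z (shift X)),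
    AR_triangle f g h /\ l = K0_class X + K0_class Z - K0_class Y.

End Grothendieck.

Arguments K0_proj {K} C _.

(* Main.v *)
(* Write [h] for the class [X] + [Z] - [Y] of a triangle X -> Y -> Z -h-> X[1].
   It only depends on the image functor of Hom(-, h), and it is additive: for
   c : W -> Z and a triangle X -x-> E -> W -hc-> X[1], [h] = [x[1] h] + [h c].
   (3) => (1): local finiteness makes the image functor of finite length; if c
   generates a simple subfunctor then [h c] is the class of the Auslander-Reiten
   triangle ending at the source of c, whose connecting morphism factors through
   h c, hence through T[1] if h does.  Conversely, the connecting morphism of the
   Auslander-Reiten triangle starting at X factors through every nonzero
   morphism to X[1], and for X outside T[1] there is one from T[1].
   (1) => (2): Z lies in a triangle P -> U -> Z -> P[1] with P and U in T; taking
   U -> Z for c, h c factors through T and x[1] h through T[1], so after a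
   shift both classes come from Auslander-Reiten triangles.
   (2) => (3): [A] + [A[1]] is a finite combination of classes [l_X], and
   dim Hom(W, -) vanishes on [l_X] for all but two indecomposable objects W. *)
From HB Require Import structures.
Require Import Defs.
From mathcomp Require Import all_boot all_order all_algebra.
From mathcomp Require Import boolp classical_sets functions cardinality.
From mathcomp Require Import freeg.
(* [all_algebra] shadows [hom]. *)
Import Defs.

Set Implicit Arguments.
Unset Strict Implicit.
Unset Printing Implicit Defensive.

Import GRing.Theory.
Local Open Scope classical_set_scope.
Local Open Scope ring_scope.

(** * Linear categories *)

Section LinearCategories.
Context {K : fieldType} {C : lin_category K}.
Implicit Types X Y Z W A B S : C.

(** Composition is named as a function of one argument so that it can carry a linear structure;
    additivity and compatibility with sums then come from [raddf] lemmas. *)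
Definition postcomp X Y Z (g : hom Y Z) : hom X Y -> hom X Z := mcomp g.

HB.instance Definition _ X Y Z (g : hom Y Z) :=
  GRing.isLinear.Build K (hom X Y) (hom X Z) _ (@postcomp X Y Z g)
    (comp_linearr g).

Definition precomp X Y Z (f : hom X Y) : hom Y Z -> hom X Z := fun g => g \oc f.

HB.instance Definition _ X Y Z (f : hom X Y) :=
  GRing.isLinear.Build K (hom Y Z) (hom X Z) _ (@precomp X Y Z f)
    (comp_linearl f).

Lemma comp0m X Y Z (f : hom X Y) : (0 : hom Y Z) \oc f = 0.
Proof. exact: (raddf0 (precomp f)). Qed.

Lemma compm0 X Y Z (g : hom Y Z) : g \oc (0 : hom X Y) = 0.
Proof. exact: (raddf0 (postcomp g)). Qed.

Lemma compDm X Y Z (f : hom X Y) (g1 g2 : hom Y Z) :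
  (g1 + g2) \oc f = g1 \oc f + g2 \oc f.
Proof. exact: (raddfD (precomp f)). Qed.

Lemma compmD X Y Z (g : hom Y Z) (f1 f2 : hom X Y) :
  g \oc (f1 + f2) = g \oc f1 + g \oc f2.
Proof. exact: (raddfD (postcomp g)). Qed.

Lemma compNm X Y Z (f : hom X Y) (g : hom Y Z) : (- g) \oc f = - (g \oc f).
Proof. exact: (raddfN (precomp f)). Qed.

Lemma compmN X Y Z (g : hom Y Z) (f : hom X Y) : g \oc (- f) = - (g \oc f).
Proof. exact: (raddfN (postcomp g)). Qed.

Lemma compBm X Y Z (f : hom X Y) (g1 g2 : hom Y Z) :
  (g1 - g2) \oc f = g1 \oc f - g2 \oc f.
Proof. exact: (raddfB (precomp f)). Qed.

Lemma compmB X Y Z (g : hom Y Z) (f1 f2 : hom X Y) :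
  g \oc (f1 - f2) = g \oc f1 - g \oc f2.
Proof. exact: (raddfB (postcomp g)). Qed.

Lemma is_iso_id X : is_iso (idm X).
Proof. by exists (idm X); rewrite comp1m. Qed.

Lemma is_isoN X Y (f : hom X Y) : is_iso f -> is_iso (- f).
Proof. by move=> [g [gf fg]]; exists (- g); rewrite !compNm !compmN !opprK. Qed.

Lemma zero_objectP Z : zero_object Z <-> idm Z = 0.
Proof.
split=> [/(_ Z)[]//|id0 X]; split=> f.
  by rewrite -[f]comp1m id0 comp0m.
by rewrite -[f]compm1 id0 compm0.
Qed.

Lemma zero_object_iso X Y : isomorphic X Y -> zero_object X -> zero_object Y.
Proof.
move=> [f [g [_ fg]]] X0; apply/zero_objectP.
by rewrite -fg ((X0 Y).2 f) comp0m.
Qed.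

Lemma is_dsumC A B S : is_dsum A B S -> is_dsum B A S.
Proof.
by move=> [i [j [p [q [? ? ? ? ?]]]]]; exists j, i, q, p; split=> //; rewrite addrC.
Qed.

Lemma is_dsum_zero Z : zero_object Z -> is_dsum Z Z Z.
Proof.
move=> Z0; exists 0, 0, 0, 0; split; rewrite ?comp0m ?addr0 //;
by apply/esym/zero_objectP.
Qed.

Lemma is_dsum_zerol A B S : is_dsum A B S -> zero_object A -> isomorphic B S.
Proof.
move=> [i [j [p [q [pi qj qi pj ij]]]]] A0; exists j, q; split=> //.
by rewrite -ij ((A0 S).2 i) comp0m add0r.
Qed.

Lemma retraction_comp X Y Z (g : hom Y Z) (f : hom X Y) :
  retraction (g \oc f) -> retraction g.
Proof. by move=> [s gfs]; exists (f \oc s); rewrite compA. Qed.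

(** The idempotents [i \oc p] and [j \oc q] add up to the identity, so locality makes one of them
    invertible. An invertible idempotent is the identity, and then the other summand vanishes. *)
Lemma local_endo_indecomposable X : local_endo X -> indecomposable X.
Proof.
move=> [idX0 Xloc]; split=> [/zero_objectP//|A B [i [j [p [q [pi qj qi pj ij]]]]]].
have idem_iso U (a : hom U X) (b : hom X U) :
    b \oc a = idm U -> is_iso (a \oc b) -> a \oc b = idm X.
  move=> ba [c [_ abc]].
  by rewrite -[a \oc b]compm1 -abc compA -(compA a b) (compA b) ba comp1m.
case: (Xloc (i \oc p) (j \oc q)); first by rewrite ij; exact: is_iso_id.
- move=> /(idem_iso _ _ _ pi) ip; right; apply/zero_objectP.
  by rewrite -qj -[q]compm1 -ip compA qi !comp0m.
- move=> /(idem_iso _ _ _ qj) jq; left; apply/zero_objectP.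
  by rewrite -pi -[p]compm1 -jq compA pj !comp0m.
Qed.

(** Locality is applied to the sum [r + (idm X - r)], whose first term cannot be invertible. *)
Lemma local_endo_sub_iso X (r : hom X X) :
  local_endo X -> ~ retraction r -> is_iso (idm X - r).
Proof.
move=> [_ Xloc] rN; case: (Xloc r (idm X - r)) => //.
  by rewrite addrC subrK; exact: is_iso_id.
by move=> [s [_ rs]]; case: rN; exists s.
Qed.

Lemma hom_summand_neq0 (C_KS : krull_schmidt C) Z Y (h : hom Z Y) : h <> 0 ->
  exists W (i : hom W Z), local_endo W /\ h \oc i <> 0.
Proof.
move=> h0; have [n [A [[i [p [_ _ ip]]] Aloc]]] := C_KS Z.
apply: contrapT => /forallNP noW; apply: h0.
rewrite -[h]compm1 -ip -[LHS]/(postcomp h _) raddf_sum big1 // => k _.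
rewrite /= /postcomp compA.
have -> : h \oc i k = 0; last exact: comp0m.
by apply: contrapT => hi; apply: (noW (A k)); exists (i k).
Qed.

End LinearCategories.

(** * Triangulated categories *)

Section Triangles.
Context {K : fieldType} {C : tri_category K}.
Implicit Types X Y Z W U V A B S : C.

Lemma shiftmD X Y (f g : hom X Y) : shiftm (f + g) = shiftm f + shiftm g.
Proof. exact: raddfD. Qed.

Lemma shiftmN X Y (f : hom X Y) : shiftm (- f) = - shiftm f.
Proof. exact: raddfN. Qed.

Lemma shiftm_inj X Y : injective (@shiftm K C X Y).
Proof. exact/bij_inj/shift_fully_faithful. Qed.

Lemma shiftm_surj X Y (u : hom (shift X) (shift Y)) :
  exists v : hom X Y, u = shiftm v.
Proof. by have [v _ vK] := shift_fully_faithful X Y; exists (v u). Qed.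

Lemma shiftm_is_iso X Y (f : hom X Y) : is_iso f -> is_iso (shiftm f).
Proof.
by move=> [g [gf fg]]; exists (shiftm g); rewrite -!shiftmM gf fg !shiftm1.
Qed.

Lemma shift_isomorphic X Y : isomorphic X Y -> isomorphic (shift X) (shift Y).
Proof. by move=> [f /shiftm_is_iso fI]; exists (shiftm f). Qed.

Lemma shift_zero_object X : zero_object X -> zero_object (shift X).
Proof. by move=> /zero_objectP X0; apply/zero_objectP; rewrite -shiftm1 X0 raddf0. Qed.

Lemma shift_section X Y (f : hom X Y) : section f -> section (shiftm f).
Proof. by move=> [g gf]; exists (shiftm g); rewrite -shiftmM gf shiftm1. Qed.

Lemma shift_retraction X Y (f : hom X Y) : retraction f -> retraction (shiftm f).
Proof. by move=> [g fg]; exists (shiftm g); rewrite -shiftmM fg shiftm1. Qed.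

Lemma unshift_retraction X Y (f : hom X Y) : retraction (shiftm f) -> retraction f.
Proof.
move=> [g]; have [g' ->] := shiftm_surj g.
by rewrite -shiftmM -shiftm1 => /shiftm_inj fg; exists g'.
Qed.

Lemma shift_dsum A B S : is_dsum A B S -> is_dsum (shift A) (shift B) (shift S).
Proof.
move=> [i [j [p [q [pi qj qi pj ij]]]]].
exists (shiftm i), (shiftm j), (shiftm p), (shiftm q).
split; rewrite -!shiftmM ?(pi, qj, qi, pj) ?shiftm1 ?raddf0 //.
by rewrite -shiftmD ij shiftm1.
Qed.

Lemma unshift_dsum A B S : is_dsum (shift A) (shift B) (shift S) -> is_dsum A B S.
Proof.
move=> [i [j [p [q]]]].
have [i' ->] := shiftm_surj i; have [j' ->] := shiftm_surj j.
have [p' ->] := shiftm_surj p; have [q' ->] := shiftm_surj q.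
rewrite -!shiftmM -shiftmD -!shiftm1.
case=> /shiftm_inj ? /shiftm_inj ? qi pj /shiftm_inj ?.
exists i', j', p', q'; split=> //; apply: shiftm_inj; by rewrite raddf0.
Qed.

Lemma triangle_id_left O W : zero_object O ->
  triangle (0 : hom O W) (idm W) (0 : hom W (shift O)).
Proof.
move=> O0; apply: (triangle_rot _ _ _).2; rewrite raddf0 oppr0.
exact/triangle_id/shift_zero_object.
Qed.

(** * Exactness of the Hom functors on a triangle *)

Section Exactness.
Context {X Y Z : C} {f : hom X Y} {g : hom Y Z} {h : hom Z (shift X)}.
Hypothesis fgh : triangle f g h.

Lemma triangle_comp_gf : g \oc f = 0.
Proof.
have [O O0] := (tri_additive C).1.
have [c [<- _]] := triangle_map (b := f) (triangle_id X O0) fgh erefl.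
by rewrite compm0.
Qed.

Lemma triangle_coker_f W (u : hom Y W) : u \oc f = 0 -> exists v, u = v \oc g.
Proof.
move=> uf; have [O O0] := (tri_additive C).1.
have [|c [cg _]] := triangle_map (a := 0) (b := u) fgh (triangle_id_left W O0).
  by rewrite uf comp0m.
by exists c; rewrite cg comp1m.
Qed.

Lemma triangle_ker_g W (u : hom W Y) : g \oc u = 0 -> exists v, u = f \oc v.
Proof.
move=> gu; have [O O0] := (tri_additive C).1.
(* A morphism from [W -> 0 -> W[1]] to the rotated triangle, with first component [u], has a third
   component [W[1] -> X[1]]; unshifting it gives the lift of [u] through [f]. *)
have tW : triangle (0 : hom W O) (0 : hom O (shift W)) (- idm (shift W)).
  by rewrite -shiftm1; apply: (triangle_rot _ _ _).1; apply: triangle_id.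
have tf := (triangle_rot _ _ _).1 fgh.
have [|c [_]] := triangle_map (a := u) (b := 0) tW tf.
  by rewrite gu comp0m.
rewrite compmN compm1 compNm => /oppr_inj.
have [v ->] := shiftm_surj c; rewrite -shiftmM => /shiftm_inj ->; by exists v.
Qed.

End Exactness.

Section MoreExactness.
Context {X Y Z : C} {f : hom X Y} {g : hom Y Z} {h : hom Z (shift X)}.
Hypothesis fgh : triangle f g h.

Let ghf : triangle g h (- shiftm f).
Proof. exact: (triangle_rot _ _ _).1. Qed.

Let hfg : triangle h (- shiftm f) (- shiftm g).
Proof. exact: (triangle_rot _ _ _).1. Qed.

Lemma triangle_rot2 : triangle h (- shiftm f) (- shiftm g).
Proof. exact: hfg. Qed.

Lemma triangle_comp_hg : h \oc g = 0.
Proof. exact: triangle_comp_gf ghf. Qed.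

Lemma triangle_ker_h W (u : hom W Z) : h \oc u = 0 -> exists v, u = g \oc v.
Proof. exact: triangle_ker_g ghf W u. Qed.

Lemma triangle_coker_g W (u : hom Z W) : u \oc g = 0 -> exists v, u = v \oc h.
Proof. exact: triangle_coker_f ghf W u. Qed.

Lemma triangle_comp_fh : shiftm f \oc h = 0.
Proof. by apply: oppr_inj; rewrite -compNm (triangle_comp_gf hfg) oppr0. Qed.

Lemma triangle_coker_h W (u : hom (shift X) W) :
  u \oc h = 0 -> exists v, u = v \oc shiftm f.
Proof.
move=> /(triangle_coker_f hfg)[v ->]; exists (- v).
by rewrite compmN compNm.
Qed.

Lemma triangle_ker_shiftf W (u : hom W (shift X)) :
  shiftm f \oc u = 0 -> exists v, u = h \oc v.
Proof. by move=> fu; apply: (triangle_ker_g hfg); rewrite compNm fu oppr0. Qed.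

Lemma triangle_ker_f W (u : hom W X) :
  f \oc u = 0 -> exists v : hom (shift W) Z, shiftm u = h \oc v.
Proof. by move=> fu; apply: triangle_ker_shiftf; rewrite -shiftmM fu raddf0. Qed.

Lemma triangle_nonretraction : h <> 0 -> ~ retraction g.
Proof.
move=> h0 [s gs]; apply: h0.
by rewrite -[h]compm1 -gs compA triangle_comp_hg comp0m.
Qed.

(** When [h] vanishes, the identity of [Z] lifts through [g] to [s], and [f] is monic. The
    projection [idm Y - s \oc g] then factors as [f \oc r]. *)
Lemma triangle_split : h = 0 -> is_dsum X Z Y.
Proof.
move=> h0; have [|s gs] := triangle_ker_h (u := idm Z); first by rewrite h0 comp0m.
have f_mono W (u : hom W X) : f \oc u = 0 -> u = 0.
  by move=> /triangle_ker_f[v uv]; apply: shiftm_inj; rewrite uv h0 comp0m raddf0.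
have gf := triangle_comp_gf fgh.
have [|r fr] := triangle_ker_g (u := idm Y - s \oc g) fgh.
  by rewrite compmB compm1 compA -gs comp1m subrr.
exists f, s, r, g; split=> //.
- apply/subr0_eq/f_mono.
  by rewrite compmB compA -fr compBm comp1m -compA gf compm0 subr0 compm1 subrr.
- apply: f_mono.
  by rewrite compA -fr compBm comp1m -compA -gs compm1 subrr.
- by rewrite -fr subrK.
Qed.

End MoreExactness.

(** Three rotations negate all three shifted morphisms; changing the sign of the middle object's
    identity removes two of the signs. *)
Lemma triangle_shift X Y Z (f : hom X Y) (g : hom Y Z) (h : hom Z (shift X)) :
  triangle f g h <-> triangle (shiftm f) (shiftm g) (- shiftm h).
Proof.
split=> [fgh|fgh].
  have t := (triangle_rot _ _ _).1 (triangle_rot2 fgh).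
  apply: (triangle_iso t (is_iso_id _) (is_isoN (is_iso_id _)) (is_iso_id _)).
  - by rewrite compNm comp1m compm1 opprK.
  - by rewrite !compmN compm1 comp1m.
  - by rewrite shiftm1 comp1m compm1.
do 3!apply: (triangle_rot _ _ _).2.
apply: (triangle_iso fgh (is_iso_id _) (is_isoN (is_iso_id _)) (is_iso_id _)).
- by rewrite !compNm comp1m compm1.
- by rewrite compNm compmN compm1 comp1m opprK.
- by rewrite shiftm1 comp1m compm1.
Qed.

Lemma triangle_fiber Y Z (g : hom Y Z) :
  exists X (f : hom X Y) (h : hom Z (shift X)), triangle f g h.
Proof.
have [N [k [l gkl]]] := triangle_ex g.
have [X [j jI]] := shift_ess_surj N; have [j' [j'j jj']] := jI.
have [f fE] := shiftm_surj (l \oc j).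
exists X, (- f), (j' \oc k); apply: (triangle_rot _ _ _).2.
rewrite shiftmN opprK -fE.
apply: (triangle_iso gkl (is_iso_id _) (is_iso_id _) (c := j')).
- by exists j.
- by rewrite comp1m compm1.
- by rewrite compm1.
- by rewrite shiftm1 comp1m -compA jj' compm1.
Qed.

Lemma triangle_cocone X Z (h : hom Z (shift X)) :
  exists Y (f : hom X Y) (g : hom Y Z), triangle f g h.
Proof.
have [Y [g [k ghk]]] := triangle_fiber h.
have [f fE] := shiftm_surj k.
exists Y, (- f), g; apply: (triangle_rot _ _ _).2.
by rewrite shiftmN opprK -fE.
Qed.

(** The cone [N] of a split monomorphism has zero connecting morphism, so [W] is the direct sum of
    [X] and [N], and indecomposability leaves [N] zero. *)
Lemma section_indecomposable_iso X W (s : hom X W) :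
  indecomposable W -> ~ zero_object X -> section s -> isomorphic X W.
Proof.
move=> [_ Wi] X0 [r rs].
have [N [k [l skl]]] := triangle_ex s.
have l0 : l = 0.
  by rewrite -[l]comp1m -shiftm1 -rs shiftmM -compA (triangle_comp_fh skl) compm0.
have XNW := triangle_split skl l0.
have [//|N0] := Wi _ _ XNW.
exact: is_dsum_zerol (is_dsumC XNW) N0.
Qed.

Lemma retraction_indecomposable_iso W Z (w : hom W Z) :
  indecomposable W -> ~ zero_object Z -> retraction w -> isomorphic Z W.
Proof.
by move=> Wi Z0 [s ws]; apply: (@section_indecomposable_iso _ _ s) => //; exists w.
Qed.

End Triangles.

(** * Grothendieck groups *)

Section GrothendieckGroups.

Lemma zmod_morphism0 (U V : zmodType) (F : U -> V) : zmod_morphism F -> F 0 = 0.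
Proof. by move=> FB; rewrite -(subrr 0) FB subrr. Qed.

Lemma zmod_morphismD (U V : zmodType) (F : U -> V) :
  zmod_morphism F -> {morph F : x y / x + y}.
Proof. by move=> FB x y; have := FB (x + y) y; rewrite addrK => ->; rewrite subrK. Qed.

Lemma quotient_proj_is_zmod_morphism (G : zmodType) (E : set G) :
  zmod_morphism (quotient_proj E).
Proof. exact: raddfB. Qed.

HB.instance Definition _ (G : zmodType) (E : set G) :=
  GRing.isZmodMorphism.Build G (quotient_by E) (quotient_proj E)
    (@quotient_proj_is_zmod_morphism G E).

Lemma Ker_quotient_proj (G : zmodType) (E : set G) :
  Ker (quotient_proj E) =i subgroup_gen E.
Proof.
move=> x; rewrite -[RHS]/(x \in subgroup_gen E) -{2}[x]subr0 Quotient.idealrBE.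
by rewrite [RHS]/= -[X in _ = (_ == X)]/(quotient_proj E 0) raddf0.
Qed.

Lemma subgroup_gen_sub (G : zmodType) (E : set G) x : E x -> x \in subgroup_gen E.
Proof. by move=> Ex; apply/asboolP => H; apply. Qed.

Lemma subgroup_gen_ind (G : zmodType) (E : set G) (P : G -> Prop) :
  P 0 -> (forall x y, P x -> P y -> P (x - y)) -> (forall x, E x -> P x) ->
  forall x, x \in subgroup_gen E -> P x.
Proof.
move=> P0 PB PE x /asboolP xE.
have Pz : zmod_closed (fun x => `[<P x>] : bool).
  by split=> [|u v /asboolP Pu /asboolP Pv]; apply/asboolP => //; exact: PB.
(* [subgroup_gen] quantifies over bundled subgroups, so [P] is made boolean and bundled. *)
pose H := HB.pack_for (zmodClosed G) (fun x => `[<P x>] : bool)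
  (GRing.isZmodClosed.Build G _ Pz).
by apply/asboolP; apply: (xE H) => y /PE Py; apply/asboolP.
Qed.

Lemma subgroup_gen_subset (G : zmodType) (E F : set G) :
  (forall x, E x -> x \in subgroup_gen F) ->
  {subset subgroup_gen E <= subgroup_gen F}.
Proof.
move=> EF; apply: (subgroup_gen_ind (P := fun x => x \in subgroup_gen F)) => //.
  exact: rpred0.
by move=> x y; exact: rpredB.
Qed.

Context {K : fieldType} {C : tri_category K}.
Implicit Types X Y Z W U V A B S : C.

Lemma class_of_eqP X Y : class_of X = class_of Y <-> isomorphic X Y.
Proof.
split=> [/eqmodP/asboolP//|XY]; apply/eqmodP; exact/asboolP.
Qed.

Lemma repr_class_of X : isomorphic (repr (class_of X)) X.
Proof. by apply/class_of_eqP; rewrite /class_of reprK. Qed.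

Lemma K0_class_iso X Y : isomorphic X Y -> K0_class X = K0_class Y.
Proof. by move=> XY; rewrite /K0_class /free_class (class_of_eqP X Y).2. Qed.

Lemma K0_class_dsum A B S : is_dsum A B S -> K0_class S = K0_class A + K0_class B.
Proof.
move=> ABS; apply/esym/subr0_eq; rewrite /K0_class -raddfD -raddfB; apply/eqP.
rewrite -[_ == 0]/(_ \in Ker _) Ker_quotient_proj.
by apply: subgroup_gen_sub; exists A, B, S.
Qed.

Lemma K0_class_zero Z : zero_object Z -> K0_class Z = 0.
Proof.
by move=> /is_dsum_zero/K0_class_dsum/eqP; rewrite -subr_eq subrr eq_sym => /eqP.
Qed.

(** Universal property of the split Grothendieck group: the extension [F] of [phi] to the free group
    kills the split relations, so its value on a representative does not depend on the choice. *)
Lemma K0_split_lift (G : zmodType) (phi : C -> G) :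
  (forall X Y, isomorphic X Y -> phi X = phi Y) ->
  (forall A B S, is_dsum A B S -> phi S = phi A + phi B) ->
  exists2 Phi : K0_split C -> G,
    zmod_morphism Phi & forall X, Phi (K0_class X) = phi X.
Proof.
move=> phi_iso phi_dsum.
(* [zmodule G] views [G] as a module over the integers, as [fglift] requires. *)
pose F : free_iso C -> G := fglift (fun c : iso_class C => phi (repr c) : zmodule G).
have FB : zmod_morphism F.
  exact: (@lift_is_additive int (iso_class C) (zmodule G : lmodType int)).
have FX X : F (free_class X) = phi X.
  by rewrite /F /free_class liftU scale1r (phi_iso _ _ (repr_class_of X)).
have F0 : forall x, x \in subgroup_gen (@split_relations K C) -> F x = 0.
  apply: subgroup_gen_ind.
  - exact: zmod_morphism0.
  - by move=> x y Fx Fy; rewrite FB Fx Fy subrr.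
  - move=> _ [A [B [S [ABS ->]]]].
    by rewrite FB (zmod_morphismD FB) !FX (phi_dsum _ _ _ ABS) subrr.
have Frepr x : F (repr (quotient_proj (@split_relations K C) x)) = F x.
  apply/subr0_eq; rewrite -FB; apply: F0; rewrite Quotient.idealrBE.
  by rewrite reprK.
exists (fun x => F (repr x)) => [x y|X]; last by rewrite Frepr FX.
rewrite -FB -[x in LHS]reprK -[y in LHS]reprK.
by rewrite -[RHS]Frepr raddfB.
Qed.

End GrothendieckGroups.

(** * Classes of triangles in the split Grothendieck group *)

Section TriangleRelations.
Context {K : fieldType} {C : tri_category K}.
Implicit Types X Y Z W U V A B S E : C.

Definition triangle_class X Y Z : K0_split C :=
  K0_class X + K0_class Z - K0_class Y.

(* Restricting h along c and composing h with the cone of h \oc c splits the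
   subfunctor generated by c off the image functor of h. *)
Lemma triangle_class_split X Y Z (f : hom X Y) (g : hom Y Z) (h : hom Z (shift X))
    W (c : hom W Z) E (x : hom X E) (y : hom E W) :
  triangle f g h -> triangle x y (h \oc c) ->
  exists Y' (f' : hom E Y') (g' : hom Y' Z), triangle f' g' (shiftm x \oc h) /\
    triangle_class X Y Z = triangle_class E Y' Z + triangle_class X E W.
Proof.
move=> fgh xyhc; have [Y' [f' [g' fgh']]] := triangle_cocone (shiftm x \oc h).
exists Y', f', g'; split=> //.
(* Octahedron on the composite of [h] and [shiftm x]: the cones [Y[1]], [Y'[1]], [W[1]] form a
   triangle whose connecting morphism is the shift of [shiftm f \oc h \oc c], which is zero. Hence
   [Y'] is the sum of [Y] and [W]. *)
have [u [v [uv _]]] := triangle_octahedron (triangle_rot2 fgh)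
  ((triangle_shift _ _ _).1 xyhc) (triangle_rot2 fgh').
have /unshift_dsum/K0_class_dsum Y'E : is_dsum (shift Y) (shift W) (shift Y').
  apply: triangle_split uv _; rewrite shiftmN compNm compmN opprK -shiftmM compA.
  by rewrite (triangle_comp_fh fgh) comp0m raddf0.
rewrite /triangle_class Y'E; apply/esym; rewrite opprD !addrA.
by rewrite [LHS](ACl (5*2*3*(6*4)*(1*7))) /= !subrr !addr0.
Qed.

(** The hypotheses say that [h] and [e] factor through each other. As in Schanuel's lemma, the
    object [Y'] completing [h \oc v] is a direct sum of [U] and [Y] as well as of [X] and [V]. *)
Lemma triangle_class_eq X Y Z (f : hom X Y) (g : hom Y Z) (h : hom Z (shift X))
    U V (u : hom U V) (v : hom V Z) (e : hom Z (shift U)) :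
  triangle f g h -> triangle u v e -> e \oc g = 0 -> h \oc v = 0 ->
  triangle_class X Y Z = triangle_class U V Z.
Proof.
move=> fgh uve eg hv; have [Y' [f' [g' fgh']]] := triangle_cocone (h \oc v).
have [p [q [pq _]]] := triangle_octahedron ((triangle_rot _ _ _).1 uve)
  (triangle_rot2 fgh) (triangle_rot2 fgh').
have /unshift_dsum/K0_class_dsum Y'E : is_dsum (shift U) (shift Y) (shift Y').
  apply: triangle_split pq _.
  by rewrite compmN -shiftmM eg raddf0 oppr0.
have /K0_class_dsum := triangle_split fgh' hv; rewrite {}Y'E => UYXV.
rewrite /triangle_class.
apply/eqP; rewrite subr_eq addrAC eq_sym subr_eq addrAC [eqbRHS]addrAC -UYXV.
by rewrite addrAC.
Qed.

Definition AR_relations : set (K0_split C) :=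
  [set l : K0_split C | exists X : C, indecomposable X /\ is_l X l].

Definition relative_AR_relations (T : set C) : set (K0_split C) :=
  [set l : K0_split C | exists X : C,
    [/\ indecomposable X, ~ shift_subcat T X & is_l X l]].

(** * Auslander-Reiten triangles *)

Section AuslanderReiten.
Context {X Y Z : C} {f : hom X Y} {g : hom Y Z} {h : hom Z (shift X)}.
Hypothesis fgh : AR_triangle f g h.

Lemma AR_third_nonzero : ~ zero_object Z.
Proof. by have [_ h0 _ _] := fgh => Z0; apply: h0; exact: (Z0 _).2. Qed.

Lemma AR_first_nonzero : ~ zero_object X.
Proof.
by have [_ h0 _ _] := fgh => /shift_zero_object X0; apply: h0; exact: (X0 _).1.
Qed.

(** The defining property concerns only shifted morphisms; essential surjectivity of the shift
    extends it to every morphism out of [X[1]]. *)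
Lemma AR_nonsection N (a : hom (shift X) N) : ~ section a -> a \oc h = 0.
Proof.
have [_ _ hl _] := fgh; have [X' [j [j' [j'j jj']]]] := shift_ess_surj N.
have [b bE] := shiftm_surj (j' \oc a).
have -> : a = j \oc shiftm b by rewrite -bE compA jj' comp1m.
move=> aN; rewrite -compA hl ?compm0// => /shift_section [r rb]; apply: aN.
by exists (r \oc j'); rewrite compA -(compA r) j'j compm1.
Qed.

Lemma AR_nonretraction Z' (c : hom Z' Z) : ~ retraction c -> h \oc c = 0.
Proof. by have [_ _ _] := fgh; apply. Qed.

(** The morphism [k] from [X[1]] to the cone of [t] is not a section, as [k \oc t = 0] and [t] is
    nonzero; hence [k] kills [h]. *)
Lemma AR_factor_right V (t : hom V (shift X)) : t <> 0 ->
  exists c, h = t \oc c.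
Proof.
move=> t0; have [N [k [l tkl]]] := triangle_ex t.
apply: (triangle_ker_g tkl); apply: AR_nonsection => -[r rk]; apply: t0.
by rewrite -[t]comp1m -rk -compA (triangle_comp_gf tkl) compm0.
Qed.

Lemma AR_factor_left S (e : hom Z S) : e <> 0 -> exists t, h = t \oc e.
Proof.
move=> e0; have [E [y [k yek]]] := triangle_fiber e.
apply: (triangle_coker_f yek); apply: AR_nonretraction => -[s ys]; apply: e0.
by rewrite -[e]compm1 -ys compA (triangle_comp_gf yek) comp0m.
Qed.

(** If both summands were nonzero, neither projection would be a section; their shifts would kill
    [h], and so would the identity. *)
Lemma AR_first_indecomposable : indecomposable X.
Proof.
have [_ h0 hX _] := fgh; split=> [|A B [i [j [p [q [pi qj qi pj ij]]]]]].
  exact: AR_first_nonzero.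
apply: contrapT => /not_orP[A0 B0]; apply: h0.
rewrite -[h]comp1m -shiftm1 -ij shiftmD !shiftmM compDm -!compA !hX ?compm0 ?addr0//.
- move=> [s sq]; apply: A0; apply/zero_objectP.
  by rewrite -pi -[i]comp1m -sq -compA qi !compm0.
- move=> [s sp]; apply: B0; apply/zero_objectP.
  by rewrite -qj -[j]comp1m -sp -compA pj !compm0.
Qed.

Lemma AR_shift : AR_triangle (shiftm f) (shiftm g) (- shiftm h).
Proof.
have [t h0 _ hZ] := fgh; split=> [|/eqP|X' a aN|Z' c cN].
- exact: (triangle_shift _ _ _).1.
- by rewrite oppr_eq0 => /eqP sh; apply: h0; apply: shiftm_inj; rewrite sh raddf0.
- have [N [j [j' [j'j jj']]]] := shift_ess_surj X'.
  have [b bE] := shiftm_surj (j' \oc a).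
  have aE : a = j \oc shiftm b by rewrite -bE compA jj' comp1m.
  rewrite compmN aE shiftmM -compA -shiftmM; have [b0 |bN] := pselect (section b).
    case: aN; rewrite aE; have [r rb] := shift_section b0.
    by exists (r \oc j'); rewrite compA -(compA r) j'j compm1.
  by have [_ _ -> //] := fgh; rewrite raddf0 compm0 oppr0.
- have [N [j [j' [j'j jj']]]] := shift_ess_surj Z'.
  have [b bE] := shiftm_surj (c \oc j).
  have cE : c = shiftm b \oc j' by rewrite -bE -compA jj' compm1.
  rewrite compNm cE compA -shiftmM hZ ?raddf0 ?comp0m ?oppr0// => /shift_retraction[s bs].
  by apply: cN; exists (j \oc s); rewrite cE compA -(compA _ j') j'j compm1.
Qed.

End AuslanderReiten.

End TriangleRelations.

(** * Local finiteness *)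

Section LocallyFiniteToRelative.
Context {K : fieldType} {C : tri_category K}.
Implicit Types X Y Z W U V A B S E : C.

Lemma ltn_sum_seq (I : eqType) (s : seq I) (F G : I -> nat) b : b \in s ->
  (forall i, F i <= G i)%N -> (F b < G b)%N ->
  (\sum_(i <- s) F i < \sum_(i <- s) G i)%N.
Proof.
move=> bs FG FGb; rewrite !(big_rem b bs) /= -addSn.
by apply: leq_add => //; apply: leq_sum.
Qed.

(** * A numerical substitute for the length of an image functor *)

Section Rank.
Variable s : seq (iso_class C).

Definition post_lfun W X Y (h : hom X Y) : 'Hom(hom W X, hom W Y) :=
  linfun (postcomp h).

Lemma post_lfunE W X Y (h : hom X Y) (c : hom W X) : post_lfun W h c = h \oc c.
Proof. exact: lfunE. Qed.

(** The total dimension of the image functor of Hom(-, h) over the classes listed in [s]. It detects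
    strict inclusions of image functors at listed objects. *)
Definition rank X Y (h : hom X Y) : nat :=
  \sum_(b <- s) \dim (limg (post_lfun (repr b : C) h)).

Lemma limg_post_comp W X Y Z (h : hom Y Z) (r : hom X Y) :
  (limg (post_lfun W (h \oc r)) <= limg (post_lfun W h))%VS.
Proof.
apply/subvP => _ /memv_imgP[c _ ->]; apply/memv_imgP.
by exists (r \oc c); rewrite ?memvf // !post_lfunE compA.
Qed.

Lemma lker_post_comp W X Y Z (h : hom X Y) (x : hom Y Z) :
  (lker (post_lfun W h) <= lker (post_lfun W (x \oc h)))%VS.
Proof.
apply/subvP => c; rewrite !memv_ker !post_lfunE => /eqP hc.
by rewrite -compA hc compm0.
Qed.

Lemma post_rank_nullity W X Y (h : hom X Y) :
  (\dim (lker (post_lfun W h)) + \dim (limg (post_lfun W h)))%N =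
  \dim {: hom W X}.
Proof. by rewrite -[RHS](limg_ker_dim (post_lfun W h)) capfv. Qed.

(** The image of Hom(-, h r) lies in that of Hom(-, h), and at [W] it misses [h \oc c]. The
    isomorphism of [W] with its chosen representative carries this to a space counted by [rank]. *)
Lemma rank_precomp_lt W X Y Z (h : hom Y Z) (r : hom X Y) (c : hom W Y) :
  class_of W \in s -> (forall v, h \oc c <> h \oc r \oc v) ->
  (rank (h \oc r) < rank h)%N.
Proof.
move=> Ws hcr; apply: (ltn_sum_seq Ws) => [b|]; first exact/dimvS/limg_post_comp.
rewrite ltn_neqAle dimvS ?limg_post_comp // andbT; apply/negP => /eqP dimE.
have [j [j' [_ jj']]] := repr_class_of W.
have /memv_imgP[v _] : h \oc (c \oc j)
    \in limg (post_lfun (repr (class_of W) : C) (h \oc r)).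
  have/eqP-> : limg (post_lfun (repr (class_of W) : C) (h \oc r)) ==
      limg (post_lfun _ h).
    by rewrite eqEdim limg_post_comp dimE leqnn.
  by apply/memv_imgP; exists (c \oc j); rewrite ?memvf // post_lfunE.
rewrite post_lfunE => hcj; apply: (hcr (v \oc j')).
by rewrite compA -hcj -!compA jj' compm1.
Qed.

(** By rank-nullity it is enough that the kernels grow; at [W] the kernel gains [c]. *)
Lemma rank_postcomp_lt W X Y Z (h : hom X Y) (x : hom Y Z) (c : hom W X) :
  class_of W \in s -> h \oc c <> 0 -> x \oc (h \oc c) = 0 ->
  (rank (x \oc h) < rank h)%N.
Proof.
move=> Ws hc xhc; apply: (ltn_sum_seq Ws) => [b|].
  rewrite -(leq_add2l (\dim (lker (post_lfun (repr b : C) h)))) post_rank_nullity.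
  rewrite -(post_rank_nullity _ (x \oc h)) leq_add2r.
  exact/dimvS/lker_post_comp.
set V := repr _; have [j [j' [_ jj']]] := repr_class_of W.
rewrite -(ltn_add2l (\dim (lker (post_lfun (V : C) h)))) post_rank_nullity.
rewrite -(post_rank_nullity _ (x \oc h)) ltn_add2r.
rewrite ltn_neqAle dimvS ?lker_post_comp // andbT; apply/negP => /eqP dimE.
have : c \oc j \in lker (post_lfun (V : C) h).
  have/eqP-> : lker (post_lfun (V : C) h) == lker (post_lfun (V : C) (x \oc h)).
    by rewrite eqEdim lker_post_comp dimE leqnn.
  by rewrite memv_ker post_lfunE compA -(compA x) xhc comp0m.
rewrite memv_ker post_lfunE => /eqP hcj; apply: hc.
by rewrite -[h \oc c]compm1 -jj' compA -(compA h) hcj comp0m.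
Qed.

(* A nonzero restriction h \oc c of minimal rank generates a simple subfunctor
   of the image functor of h. *)
Lemma exists_socle (C_KS : krull_schmidt C) Z Y (h : hom Z Y) :
  (forall W (u : hom W Z), indecomposable W -> u <> 0 -> class_of W \in s) ->
  h <> 0 ->
  exists W (c : hom W Z), [/\ indecomposable W, h \oc c <> 0 &
    forall W' (r : hom W' W), ~ retraction r -> h \oc c \oc r = 0].
Proof.
move=> cover h0.
pose P n := exists W (c : hom W Z),
  [/\ local_endo W, h \oc c <> 0 & rank (h \oc c) = n].
have exP : exists n, `[< P n >].
  have [W [c [Wl hc]]] := hom_summand_neq0 C_KS h0.
  by exists (rank (h \oc c)); apply/asboolP; exists W, c.
case: (ex_minnP exP) => n /asboolP[W [c [Wl hc <-]]] min.
have Wi := local_endo_indecomposable Wl.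
exists W, c; split=> // W' r rN; apply: contrapT => hcr.
have [V [i [Vl hcri]]] := hom_summand_neq0 C_KS hcr.
suff : (rank (h \oc c \oc (r \oc i)) < rank (h \oc c))%N.
  rewrite ltnNge min //; apply/asboolP; exists V, (c \oc (r \oc i)).
  by split; rewrite // !compA.
(* If the rank did not drop, [h \oc c] would equal [h \oc c \oc (r \oc i \oc v)] for some [v]. As
   [r] is not a retraction, [idm W] minus [r \oc i \oc v] is invertible, which forces
   [h \oc c = 0]. *)
apply: (@rank_precomp_lt W _ _ _ _ _ (idm W)) => [|v].
  by apply: (cover _ c) => // c0; apply: hc; rewrite c0 compm0.
rewrite compm1 => hcv; apply: hc.
have riN : ~ retraction (r \oc i \oc v).
  by rewrite -compA => /retraction_comp.
have [k [_ ik]] := local_endo_sub_iso Wl riN.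
by rewrite -[h \oc c]compm1 -ik compA compmB compm1 compA -hcv subrr comp0m.
Qed.

End Rank.

(** A nonzero morphism to [Z] has a nonzero component in one of the finitely many local summands, so
    the lists of the summands are concatenated. *)
Lemma exists_cover (C_KS : krull_schmidt C) (C_lf : locally_finite C) Z :
  exists s : seq (iso_class C),
    forall W (u : hom W Z), indecomposable W -> u <> 0 -> class_of W \in s.
Proof.
have [n [A [[i [p [_ _ ip]]] Al]]] := C_KS Z.
have /choice[s sP] : forall k, exists s : seq (iso_class C),
    forall W (u : hom W (A k)), indecomposable W -> u <> 0 -> class_of W \in s.
  move=> k; have [_ /finite_seqP[s sE]] := C_lf _ (local_endo_indecomposable (Al k)).
  exists s => W u Wi u0.
  have : [set` s] (class_of W) by rewrite -sE; exists W; split=> //; exists u.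
  by [].
exists (flatten [seq s k | k <- enum 'I_n]) => W u Wi u0.
have [k pu] : exists k, p k \oc u <> 0.
  apply: contrapT => /forallNP pu; apply: u0.
  rewrite -[u]comp1m -ip -[LHS]/(precomp u _) raddf_sum big1 //= => k _.
  by rewrite /precomp -compA (contrapT (pu k)) compm0.
by apply/flatten_mapP; exists k; rewrite ?mem_enum //; apply: sP pu.
Qed.

(** * Relative triangles and Auslander-Reiten triangles *)

Section ClusterTilting.
Context {T : set C} (T_ct : cluster_tilting T).

Lemma ct_rightP X : T X <-> forall U, T U -> forall f : hom U (shift X), f = 0.
Proof. by rewrite {1}(ct_right T_ct). Qed.

(** This is the rigidity Hom(T, T[1]) = 0 transported along the shift. *)
Lemma shift_subcat_hom0 U V (b : hom V (shift U)) :
  shift_subcat T U -> shift_subcat T V -> b = 0.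
Proof.
move=> [U' TU' [k [k' [k'k kk']]]] [V' TV' [j [j' [j'j jj']]]].
have [w wE] := shiftm_surj (shiftm k \oc (b \oc j')).
have w0 : w = 0 by exact: (ct_rightP U').1.
rewrite -[b]comp1m -shiftm1 -k'k shiftmM -compA -[b]compm1 -j'j (compA b).
by rewrite (compA (shiftm k)) wE w0 raddf0 comp0m compm0.
Qed.

(** Induction on the rank of [h], with [Z] and hence the list [s] fixed. Replacing [h] by
    [shiftm x \oc h] kills the socle element [c], which lowers the rank, and preserves the
    factorization through [T[1]]. *)
Lemma triangle_class_AR_generated (C_KS : krull_schmidt C)
    (C_AR : has_AR_triangles C) (C_lf : locally_finite C)
    X Y Z (f : hom X Y) (g : hom Y Z) (h : hom Z (shift X)) :
  triangle f g h -> factors_through_subcat (shift_subcat T) h ->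
  triangle_class X Y Z \in subgroup_gen (relative_AR_relations T).
Proof.
have [s cover] := exists_cover C_KS C_lf Z.
move: {2}(rank s h).+1 (ltnSn (rank s h)) => n.
elim: n X Y f g h => // n IHn X Y f g h hn fgh [V [a [b [TV hE]]]].
have [h0|h0] := pselect (h = 0).
  have /K0_class_dsum YE := triangle_split fgh h0.
  by rewrite /triangle_class YE subrr rpred0.
have [W [c [Wi hc hcr]]] := exists_socle C_KS cover h0.
have [E [x [y xye]]] := triangle_cocone (h \oc c).
have [Y' [f' [g' [fgh' ->]]]] := triangle_class_split fgh xye.
apply: rpredD.
  apply: (IHn _ _ _ _ _ _ fgh'); last first.
    by exists V, a, (shiftm x \oc b); rewrite hE compA.
  move: hn; rewrite ltnS; apply: leq_trans; apply: (rank_postcomp_lt (c := c)) => //.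
    by apply: (cover _ c) => // c0; apply: hc; rewrite c0 compm0.
  exact: triangle_comp_fh xye.
have [_ [U [V' [u [v [e uve]]]]]] := C_AR W Wi.
have [tuve e0 _ _] := uve.
(* Both [h \oc c] and the Auslander-Reiten morphism [e] kill all nonretractions into [W], so the two
   triangles ending at [W] have the same class. *)
rewrite (triangle_class_eq xye tuve).
- apply: subgroup_gen_sub; exists U; split.
  + exact: AR_first_indecomposable uve.
  (* [e] factors through [h \oc c], hence through a morphism [V -> U[1]] with [V] in [T[1]]; this is
     zero if [U] is in [T[1]] too. *)
  + move=> TU; apply: e0; have [t ->] := AR_factor_left uve hc.
    by rewrite hE -compA compA (shift_subcat_hom0 (t \oc b)) ?comp0m.
  + by exists V', W, u, v, e.
- by apply: (AR_nonretraction uve); apply: triangle_nonretraction xye hc.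
- by apply: hcr; apply: triangle_nonretraction tuve e0.
Qed.

(** With [X] isomorphic to [X'[1]] and [X'] outside [T], there is a nonzero morphism from an object
    of [T] to [X'[1]]; its shift gives a nonzero morphism from [T[1]] to [X[1]], through which [h]
    factors. *)
Lemma AR_factors_through_shift X Y Z (f : hom X Y) (g : hom Y Z)
    (h : hom Z (shift X)) :
  AR_triangle f g h -> ~ shift_subcat T X ->
  factors_through_subcat (shift_subcat T) h.
Proof.
move=> fgh XT; have [X' [j [j' [j'j jj']]]] := shift_ess_surj X.
have /(contra_not (ct_rightP X').2) : ~ T X'.
  by move=> TX'; apply: XT; exists X' => //; exists j', j.
move=> /existsNP[U /not_implyP[TU /existsNP[w w0]]].
have [|c hE] := AR_factor_right fgh (t := shiftm (j \oc w)).
  rewrite -[RHS](raddf0 shiftm) => /shiftm_inj jw; apply: w0.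
  by rewrite -[w]comp1m -j'j -compA jw compm0.
exists (shift U), c, (shiftm (j \oc w)); split=> //.
by exists U => //; exact: isomorphic_refl.
Qed.

End ClusterTilting.

End LocallyFiniteToRelative.

(** * Cluster tilting *)

Section RelativeToAbsolute.
Context {K : fieldType} {C : tri_category K}.
Implicit Types X Y Z W U V A B S E P : C.

Lemma triangle_unshift X Y Z (f : hom X Y) (g : hom Y Z) (h : hom Z (shift X)) :
  triangle f g h ->
  exists X' Y' Z' (f' : hom X' Y') (g' : hom Y' Z') (h' : hom Z' (shift X')),
    [/\ triangle f' g' h', isomorphic (shift X') X, isomorphic (shift Y') Y
      & isomorphic (shift Z') Z].
Proof.
move=> fgh.
have [X' [a [a' [a'a aa']]]] := shift_ess_surj X.
have [Y' [b [b' [b'b bb']]]] := shift_ess_surj Y.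
have [Z' [c [c' [c'c cc']]]] := shift_ess_surj Z.
have [f' fE] := shiftm_surj (b' \oc f \oc a).
have [g' gE] := shiftm_surj (c' \oc g \oc b).
(* The sign anticipates the one in [triangle_shift]. *)
have [h' hE] := shiftm_surj (- (shiftm a' \oc h \oc c)).
exists X', Y', Z', f', g', h'; split; last first.
- by exists c, c'.
- by exists b, b'.
- by exists a, a'.
apply: (triangle_shift _ _ _).2; rewrite -fE -gE -hE opprK.
apply: (triangle_iso fgh (a := a') (b := b') (c := c')).
- by exists a.
- by exists b.
- by exists c.
- by rewrite -compA aa' compm1.
- by rewrite -compA bb' compm1.
- by rewrite -compA cc' compm1.
Qed.

(** Wakamatsu's argument: [a] is a right approximation and [P] its fiber. A morphism [w] from [S] in
    [T] to [P[1]] dies in [U[1]], so it is [b \oc v]; since [v] factors through [a] and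
    [b \oc a = 0], it vanishes. *)
Lemma cluster_tilting_triangle (T : set C) (T_ct : cluster_tilting T) Z :
  exists P U (p : hom P U) (a : hom U Z) (b : hom Z (shift P)),
    [/\ triangle p a b, T P & T U].
Proof.
have [[U [a [TU aP]]] _] := ct_functorially_finite T_ct Z.
have [P [p [b pab]]] := triangle_fiber a.
exists P, U, p, a, b; split=> //; apply/(ct_rightP T_ct) => S TS w.
have [v wE] := triangle_ker_shiftf pab ((ct_rightP T_ct U).1 TU S TS (shiftm p \oc w)).
have [s vE] := aP S v TS.
by rewrite wE vE compA (triangle_comp_hg pab) comp0m.
Qed.

Lemma K0_shift_exists : exists2 sigma : K0_split C -> K0_split C,
  zmod_morphism sigma & forall X, sigma (K0_class X) = K0_class (shift X).
Proof.
apply: K0_split_lift => [X Y XY|A B S ABS].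
  exact/K0_class_iso/shift_isomorphic.
exact/K0_class_dsum/shift_dsum.
Qed.

Lemma triangle_generated_by_AR (T : set C) (T_ct : cluster_tilting T) :
  {subset subgroup_gen (relative_relations T) <=
    subgroup_gen (relative_AR_relations T)} ->
  {subset subgroup_gen (@triangle_relations K C) <=
    subgroup_gen (@AR_relations K C)}.
Proof.
set LT := subgroup_gen (relative_AR_relations T).
set L := subgroup_gen (@AR_relations K C) => relL.
have [sigma sigmaB sigmaE] := K0_shift_exists.
have sigmaD := zmod_morphismD sigmaB.
have sigma_class X Y Z :
    sigma (triangle_class X Y Z) = triangle_class (shift X) (shift Y) (shift Z).
  by rewrite sigmaB sigmaD !sigmaE.
have LTL : {subset LT <= L}.
  apply: subgroup_gen_subset => l [X [Xi _ lX]].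
  by apply: subgroup_gen_sub; exists X.
(* The shift of an Auslander-Reiten triangle is one again, but its first term may land in [T[1]], so
   the target is [L] and not [LT]. *)
have sigmaL x : x \in LT -> sigma x \in L.
  move: x; apply: (subgroup_gen_ind (P := fun x => sigma x \in L)).
  - by rewrite zmod_morphism0 // rpred0.
  - by move=> x y xL yL; rewrite sigmaB rpredB.
  - move=> l [X [Xi _ [Y [Z [f [g [h [fgh ->]]]]]]]].
    apply: subgroup_gen_sub; exists (shift X); split.
      exact: AR_first_indecomposable (AR_shift fgh).
    exists (shift Y), (shift Z), (shiftm f), (shiftm g), (- shiftm h).
    by split; [exact: AR_shift|exact: sigma_class].
have in_LT X Y Z (f : hom X Y) (g : hom Y Z) (h : hom Z (shift X)) :
    triangle f g h -> factors_through_subcat (shift_subcat T) h ->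
    triangle_class X Y Z \in LT.
  by move=> fgh hT; apply: relL; apply: subgroup_gen_sub; exists X, Y, Z, f, g, h.
apply: subgroup_gen_subset => _ [X0 [Y0 [Z0 [f0 [g0 [h0 [fgh0 ->]]]]]]].
(* The triangle is written as a shift up to isomorphism, so that its class can be split one shift
   earlier. *)
have [X [Y [Z [f [g [h [fgh XX0 YY0 ZZ0]]]]]]] := triangle_unshift fgh0.
rewrite -(K0_class_iso XX0) -(K0_class_iso YY0) -(K0_class_iso ZZ0).
rewrite -[_ - _]sigma_class.
have [P [U [p [a [b [pab TP TU]]]]]] := cluster_tilting_triangle T_ct Z.
have [E [x [y xye]]] := triangle_cocone (h \oc a).
have [Y' [f' [g' [fgh' ->]]]] := triangle_class_split fgh xye.
(* The morphism [shiftm x \oc h] kills [a], so it factors through [P[1]] and its class is relative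
   before shifting. The morphism [h \oc a] passes through [U] in [T], so its class becomes relative
   after shifting. *)
rewrite sigmaD rpredD //.
  apply/sigmaL/(in_LT _ _ _ _ _ _ fgh').
  have [|t ->] := triangle_coker_g pab (u := shiftm x \oc h).
    by rewrite -compA (triangle_comp_fh xye).
  by exists (shift P), b, t; split=> //; exists P => //; exact: isomorphic_refl.
rewrite sigma_class; apply/LTL/(in_LT _ _ _ _ _ _ ((triangle_shift _ _ _).1 xye)).
exists (shift U), (idm _), (- shiftm (h \oc a)); rewrite compm1; split=> //.
by exists U => //; exact: isomorphic_refl.
Qed.

End RelativeToAbsolute.

(** * Hom dimensions *)

Section AbsoluteToLocallyFinite.
Context {K : fieldType}.

Lemma dim_exact (U V W : vectType K) (f : {linear U -> V}) (g : {linear V -> W}) :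
  injective f -> (forall w, exists v, w = g v) ->
  (forall v, g v = 0 <-> exists u, v = f u) -> dim V = (dim U + dim W)%N.
Proof.
move=> f_inj g_surj fg; rewrite -!dimvf.
rewrite -(limg_ker_dim (linfun g) fullv) capfv.
have -> : lker (linfun g) = limg (linfun f).
  apply/vspaceP => v; rewrite memv_ker lfunE; apply/eqP/memv_imgP.
    by move=> /fg[u ->]; exists u; rewrite ?memvf // lfunE.
  by move=> [u _ ->]; apply/fg; exists u; rewrite lfunE.
have -> : limg (linfun g) = fullv.
  apply/vspaceP => w; rewrite memvf; apply/memv_imgP.
  by have [v ->] := g_surj w; exists v; rewrite ?memvf // lfunE.
rewrite limg_dim_eq //; apply/eqP; rewrite capfv; apply/lker0P => u v.
by rewrite !lfunE; exact: f_inj.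
Qed.

Lemma dim_eq0 (V : vectType K) (v : V) : dim V = 0%N -> v = 0.
Proof.
rewrite -dimvf => /eqP; rewrite dimv_eq0 => /eqP V0.
by apply/eqP; rewrite -memv0 -V0 memvf.
Qed.

Context {C : tri_category K}.
Implicit Types X Y Z W U V A B S E P : C.

Lemma dim_hom_dsum_right W A B S : is_dsum A B S ->
  dim (hom W S) = (dim (hom W A) + dim (hom W B))%N.
Proof.
move=> [i [j [p [q [pi qj qi pj ij]]]]].
apply: (@dim_exact _ _ _ (postcomp i) (postcomp q)) => [u v|w|v].
- move=> /= /(congr1 (mcomp p)).
  by rewrite /postcomp !compA pi !comp1m.
- by exists (j \oc w); rewrite /= /postcomp compA qj comp1m.
- rewrite /= /postcomp; split=> [qv|[u ->]]; last by rewrite compA qi comp0m.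
  by exists (p \oc v); rewrite -[LHS]comp1m -ij compDm -!compA qv compm0 addr0.
Qed.

Lemma dim_hom_dsum_left W A B S : is_dsum A B S ->
  dim (hom S W) = (dim (hom A W) + dim (hom B W))%N.
Proof.
move=> [i [j [p [q [pi qj qi pj ij]]]]].
apply: (@dim_exact _ _ _ (precomp p) (precomp j)) => [u v|w|v].
- move=> /= /(congr1 (fun k => k \oc i)).
  by rewrite /precomp -!compA pi !compm1.
- by exists (w \oc q); rewrite /= /precomp -compA qj compm1.
- rewrite /= /precomp; split=> [vj|[u ->]]; last by rewrite -compA pj compm0.
  by exists (v \oc i); rewrite -[LHS]compm1 -ij compmD !compA vj comp0m addr0.
Qed.

Lemma is_dsum_zero_iso O X Y : zero_object O -> isomorphic X Y -> is_dsum O X Y.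
Proof.
move=> O0 [f [g [gf fg]]]; exists 0, f, 0, g; split=> //.
- by rewrite comp0m; apply/esym/zero_objectP.
- exact: compm0.
- exact: comp0m.
- by rewrite comp0m add0r.
Qed.

(** The function [d] stands for the dimension of Hom in either direction, so one argument serves
    both halves of local finiteness. *)
Lemma finite_support (d : C -> C -> nat) :
  (forall W A B S, is_dsum A B S -> d W S = d W A + d W B)%N ->
  (forall X Y Z (f : hom X Y) (g : hom Y Z) (h : hom Z (shift X)),
     AR_triangle f g h -> exists s : seq (iso_class C), forall W,
       indecomposable W -> class_of W \notin s -> d W Y = (d W X + d W Z)%N) ->
  {subset subgroup_gen (@triangle_relations K C) <=
    subgroup_gen (@AR_relations K C)} ->
  forall A, finite_set [set b | exists B : C,
    [/\ indecomposable B, b = class_of B & d B A <> 0%N]].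
Proof.
move=> d_dsum d_AR relL A.
have [O O0] := (tri_additive C).1.
have d_iso W X Y : isomorphic X Y -> d W X = d W Y.
  move=> XY; rewrite (d_dsum W O X Y (is_dsum_zero_iso O0 XY)).
  have := d_dsum W _ _ _ (is_dsum_zero O0).
  by rewrite -[LHS]addn0 => /addnI <-.
(* Quantifying over all additive extensions [Phi] of [d W] avoids choosing one for each [W];
   [K0_split_lift] supplies one at the end. *)
pose vanishing_off (s : seq (iso_class C)) (x : K0_split C) :=
  forall W (Phi : K0_split C -> int), indecomposable W -> class_of W \notin s ->
    zmod_morphism Phi -> (forall X, Phi (K0_class X) = (d W X)%:Z) -> Phi x = 0.
have vanish : forall x, x \in subgroup_gen (@triangle_relations K C) ->
    exists s, vanishing_off s x.
  move=> x /relL; move: x; apply: subgroup_gen_ind.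
  - by exists [::] => W Phi _ _ PhiB _; exact: zmod_morphism0.
  - move=> x y [s sx] [t ty]; exists (s ++ t) => W Phi Wi.
    rewrite mem_cat negb_or => /andP[Ws Wt] PhiB PhiE.
    by rewrite PhiB (sx W Phi) // (ty W Phi) // subrr.
  - move=> _ [X [_ [Y [Z [f [g [h [/d_AR[s sP] ->]]]]]]]].
    exists s => W Phi Wi Ws PhiB PhiE.
    by rewrite PhiB (zmod_morphismD PhiB) !PhiE (sP W) // PoszD subrr.
(* The triangle [A -> 0 -> A[1]] has class [[A] + [A[1]]]; as [d] takes natural values, vanishing of
   the sum makes [d B A] vanish. *)
have [s sP] : exists s, vanishing_off s (K0_class A + K0_class (shift A)).
  apply: vanish; apply: subgroup_gen_sub.
  exists A, O, (shift A), 0, 0, (- shiftm (idm A)); split.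
    by apply: (triangle_rot _ _ _).1; exact: triangle_id.
  by rewrite (K0_class_zero O0) subr0.
apply: (sub_finite_set _ (finite_seq s)) => _ [B [Bi -> dBA]].
apply: contrapT => /negP Bs; apply: dBA.
have [X Y XY|X Y S XYS|Phi PhiB PhiE] := @K0_split_lift _ C int (fun X => (d B X)%:Z).
- by rewrite (d_iso B _ _ XY).
- by rewrite (d_dsum B _ _ _ XYS) PoszD.
have /eqP := sP B Phi Bi Bs PhiB PhiE.
by rewrite (zmod_morphismD PhiB) !PhiE -PoszD eqz_nat addn_eq0 => /andP[/eqP].
Qed.

Section HomDimensions.
Context {X Y Z : C} {f : hom X Y} {g : hom Y Z} {h : hom Z (shift X)}.
Hypothesis fgh : AR_triangle f g h.

(** Hom(W, -) turns the triangle into a short exact sequence as soon as no morphism from [W] or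
    [W[1]] to [Z] is a retraction. This excludes only the classes of [Z] and of its unshift [Z']. *)
Lemma AR_dim_hom_right : exists s : seq (iso_class C), forall W,
  indecomposable W -> class_of W \notin s ->
  dim (hom W Y) = (dim (hom W X) + dim (hom W Z))%N.
Proof.
have [Z' [j [j' [j'j jj']]]] := shift_ess_surj Z.
have Z0 := AR_third_nonzero fgh.
have Z'0 : ~ zero_object Z'.
  by move=> /shift_zero_object/zero_object_iso Z'0; apply/Z0/Z'0; exists j, j'.
exists [:: class_of Z; class_of Z'] => W Wi; rewrite !inE negb_or.
move=> /andP[/eqP WZ /eqP WZ']; have [t _ _ _] := fgh.
have nonretraction V (w : hom W V) : ~ zero_object V -> class_of W <> class_of V ->
    ~ retraction w.
  move=> V0 WV /(retraction_indecomposable_iso Wi V0)/class_of_eqP VW.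
  by apply: WV.
apply: (@dim_exact _ _ _ (postcomp f) (postcomp g)) => [|w|v].
- move=> u v /= /eqP; rewrite -subr_eq0 -compmB => /eqP /(triangle_ker_f t)[w uv].
  have [w' wE] := shiftm_surj (j' \oc w).
  apply/subr0_eq/shiftm_inj; rewrite raddf0 uv -[w]comp1m -jj' -(compA j) wE.
  apply: (AR_nonretraction fgh) => -[s ws].
  apply: (nonretraction _ w' Z'0 WZ'); apply: unshift_retraction; exists (s \oc j).
  by rewrite -[LHS]comp1m -j'j -!compA (compA j) (compA _ s) ws comp1m.
- by apply: (triangle_ker_h t); apply: (AR_nonretraction fgh); exact: nonretraction.
- split=> [|[u ->]]; first exact: (triangle_ker_g t).
  by rewrite /= /postcomp compA (triangle_comp_gf t) comp0m.
Qed.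

(** Dually, a section from [X] or [X[1]] to the indecomposable [W] would be an isomorphism, so those
    two classes are excluded. *)
Lemma AR_dim_hom_left : exists s : seq (iso_class C), forall W,
  indecomposable W -> class_of W \notin s ->
  dim (hom Y W) = (dim (hom X W) + dim (hom Z W))%N.
Proof.
have X0 := AR_first_nonzero fgh.
have sX0 : ~ zero_object (shift X).
  move=> /(_ (shift X))[/(_ (idm _)) idX _].
  by apply/X0/zero_objectP/shiftm_inj; rewrite shiftm1 idX raddf0.
exists [:: class_of X; class_of (shift X)] => W Wi; rewrite !inE negb_or.
move=> /andP[/eqP WX /eqP WX']; have [t _ ar _] := fgh.
have nonsection V (w : hom V W) : ~ zero_object V -> class_of W <> class_of V ->
    ~ section w.
  move=> V0 WV /(section_indecomposable_iso Wi V0)/class_of_eqP VW.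
  by apply: WV.
(* By contravariance, Hom(Z, W) is the subspace and Hom(X, W) the quotient. *)
rewrite addnC.
apply: (@dim_exact _ _ _ (precomp g) (precomp f)) => [|w|v].
- move=> u v /= /eqP; rewrite -subr_eq0 -compBm => /eqP /(triangle_coker_g t)[w uv].
  apply/subr0_eq; rewrite uv; apply: (AR_nonsection fgh); exact: nonsection.
- have wh : shiftm w \oc h = 0 by apply: ar; exact: nonsection.
  have [v wE] := triangle_coker_h t wh.
  have [v' vE] := shiftm_surj v.
  by exists v'; apply: shiftm_inj; rewrite /= /precomp shiftmM -vE.
- split=> [|[u ->]]; first exact: (triangle_coker_f t).
  by rewrite /= /precomp -compA (triangle_comp_gf t) compm0.
Qed.

End HomDimensions.

Lemma triangle_generated_locally_finite :
  {subset subgroup_gen (@triangle_relations K C) <=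
    subgroup_gen (@AR_relations K C)} ->
  locally_finite C.
Proof.
move=> relL A _; split.
- apply: sub_finite_set (finite_support (d := fun W X => dim (hom X W))
    (fun W _ _ _ => @dim_hom_dsum_left W _ _ _)
    (fun _ _ _ _ _ _ => AR_dim_hom_left) relL A).
  by move=> _ [B [Bi -> [f f0]]]; exists B; split=> // /(dim_eq0 f).
- apply: sub_finite_set (finite_support (d := fun W X => dim (hom W X))
    (fun W _ _ _ => @dim_hom_dsum_right W _ _ _)
    (fun _ _ _ _ _ _ => AR_dim_hom_right) relL A).
  by move=> _ [B [Bi -> [f f0]]]; exists B; split=> // /(dim_eq0 f).
Qed.

End AbsoluteToLocallyFinite.

Theorem corollary4p16 (K : fieldType) (C : tri_category K) (T : set C)
    (C_nonzero : exists X : C, ~ zero_object X)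
    (C_KS : krull_schmidt C)
    (C_AR : has_AR_triangles C)
    (T_ct : cluster_tilting T) :
  [<-> Ker (K0_rel_proj T) =i subgroup_gen
         [set l : K0_split C | exists X : C,
            [/\ indecomposable X, ~ shift_subcat T X & is_l X l]];
       Ker (K0_proj C) =i subgroup_gen
         [set l : K0_split C | exists X : C, indecomposable X /\ is_l X l];
       locally_finite C].
Proof.
(* The cycle is (1) => (2) => (3) => (1). In the first and last implications the listed classes are
   themselves defining relations, which gives the easy inclusion. *)
tfae.
- move=> relE x; rewrite Ker_quotient_proj; apply/idP/idP; move: x.
    apply: (triangle_generated_by_AR T_ct) => x.
    by rewrite -relE Ker_quotient_proj.
  apply: subgroup_gen_subset => l [X [_ [Y [Z [f [g [h [[t _ _ _] ->]]]]]]]].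
  by apply: subgroup_gen_sub; exists X, Y, Z, f, g, h.
- move=> triE; apply: triangle_generated_locally_finite => x.
  by rewrite -triE Ker_quotient_proj.
- move=> C_lf x; rewrite Ker_quotient_proj; apply/idP/idP; move: x;
    apply: subgroup_gen_subset.
    move=> _ [X [Y [Z [f [g [h [t hT ->]]]]]]].
    exact: (triangle_class_AR_generated T_ct C_KS C_AR C_lf t hT).
  move=> l [X [_ TX [Y [Z [f [g [h [fgh ->]]]]]]]].
  apply: subgroup_gen_sub; exists X, Y, Z, f, g, h; split=> //; first by case: fgh.
  exact: AR_factors_through_shift fgh TX.
Qed.
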